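(* Assume that $Z$ has a finite second moment, that the linearity condition $Q_c\,\mathbb{E}[Z|P_cZ]=0$ a.s. holds, and that for every nonzero vector $\eta\in E_c$, the random variable $\mathbb{E}[\eta^TZ|Y]$ has a nonzero variance. If $\Psi$ is a total countable family in the space $L_1\big(\mathbb{E}[\|Z\|\,|Y=y]\,P_Y(dy)\big)$, then we can extract a finite subset $\Psi_H$ of $\Psi$ such that $$\operatorname{span}\left(\mathbb{E}[Z\psi(Y)],\ \psi\in\Psi_H\right)=E_c.$$
   Context: $Y$ is a real random variable, $X$ a random vector in $\mathbb{R}^p$ with invertible covariance matrix $\Sigma$, and $Z=\Sigma^{-1/2}(X-\mathbb{E}[X])$, so $\mathbb{E}[Z]=0$ and $\operatorname{var}(Z)=I$. A dimension reduction subspace (DRS) for $Z$ is a linear subspace $E\subset\mathbb{R}^p$ such that $Y$ and $Z$ are conditionally independent given $PZ$, $P$ being the orthogonal projection on $E$. The (standardized) central subspace $E_c$ is the unique DRS of minimal dimension, equal to the intersection of all DRS. Standing assumption: $X$ has a density whose support has a boundary of Lebesgue measure $0$, and $E_c$ exists. $P_c$ is the orthogonal projection on $E_c$ and $Q_c=I-P_c$. $P_Y$ is the law of $Y$. For $\theta:\mathbb{R}\to\mathbb{R}_+$ and a measure $\mu$ on $\mathbb{R}$, $L_1(\theta(y)\mu(dy))$ is the space of functions $u:\mathbb{R}\to\mathbb{R}$ with $\int|u(y)|\theta(y)\mu(dy)<\infty$. A family is total if its linear span is dense. *)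

(* Defs.v *)
From HB Require Import structures.
From mathcomp Require Import all_boot all_order all_algebra.
From mathcomp Require Import all_classical all_reals all_analysis.

Set Implicit Arguments.
Unset Strict Implicit.
Unset Printing Implicit Defensive.

Import Order.TTheory GRing.Theory Num.Theory numFieldNormedType.Exports.

Local Open Scope classical_set_scope.
Local Open Scope ring_scope.

(** Column vectors carry the product sigma-algebra, like [n.-tuple R] in
    MathComp-Analysis; over the reals this is the Borel sigma-algebra. *)

Definition measure_col_display : measure_display -> measure_display.
Proof. exact. Qed.

Section measurable_col.
Context {R : realType} (p : nat).

Let coors : 'I_p -> 'cV[R]_p -> R := fun i v => v i 0.

Let col_set0 : g_sigma_preimage coors set0.
Proof. exact: sigma_algebra0. Qed.

Let col_setC A : g_sigma_preimage coors A -> g_sigma_preimage coors (~` A).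
Proof. exact: sigma_algebraC. Qed.

Let col_bigcup (F : (set 'cV[R]_p)^nat) :
  (forall i, g_sigma_preimage coors (F i)) ->
  g_sigma_preimage coors (\bigcup_i (F i)).
Proof. exact: sigma_algebra_bigcup. Qed.

HB.instance Definition _ := @isMeasurable.Build
  (measure_col_display default_measure_display)
  'cV[R]_p (g_sigma_preimage coors) col_set0 col_setC col_bigcup.

End measurable_col.

Section measurable_coor.
Context {R : realType}.

Lemma measurable_coor (p : nat) (i : 'I_p) :
  measurable_fun [set: 'cV[R]_p] (fun v => v i 0).
Proof.
move=> _ B mB; rewrite setTI; apply: sub_sigma_algebra => /=.
rewrite -bigcup_seq/=; exists i => /=; first by rewrite mem_index_enum.
by exists B => //; rewrite setTI.
Qed.

Lemma measurable_fun_colP d (T : measurableType d) (p : nat)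
    (f : T -> 'cV[R]_p) :
  (forall i, measurable_fun [set: T] (fun x => f x i 0)) ->
  measurable_fun [set: T] f.
Proof.
move=> mf _ B mB.
suff /(_ _ mB) : @measurable _ 'cV[R]_p `<=`
    image_set_system setT f (@measurable _ T) by [].
apply: smallest_sub.
  exact/sigma_algebra_image/sigma_algebra_measurable.
rewrite -bigcup_seq; apply: bigcup_sub => i _ _ [C mC <-].
by rewrite /image_set_system/= setTI; exact: mf.
Qed.

End measurable_coor.

(** Lebesgue measure on R^p, by recursion on the dimension: the image of the
    product of the one-dimensional measure and the measure on R^(p-1). *)

Section lebesgue_cons.
Context {R : realType} (p : nat).
Variable mu : {sigma_finite_measure set 'cV[R]_p -> \bar R}.

Definition cons_col (x : measurableTypeR R * 'cV[R]_p) : 'cV[R]_p.+1 :=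
  \col_i oapp (fun j => x.2 j 0) x.1 (unlift ord0 i).

Lemma measurable_cons_col : 
  measurable_fun [set: measurableTypeR R * 'cV[R]_p] cons_col.
Proof.
apply: measurable_fun_colP => i; case: (unliftP ord0 i) => [j|] ->.
- rewrite [X in measurable_fun _ X](_ : _ = (fun v : 'cV_p => v j 0) \o snd).
    by apply: measurableT_comp => //; exact: measurable_coor.
  by apply/funext => x; rewrite mxE liftK.
- rewrite [X in measurable_fun _ X](_ : _ = fst)//.
  by apply/funext => x; rewrite mxE unlift_none.
Qed.

HB.instance Definition _ :=
  isMeasurableFun.Build _ _ _ _ cons_col measurable_cons_col.

Definition lebesgue_cons : set 'cV[R]_p.+1 -> \bar R :=
  pushforward (lebesgue_measure \x mu)%E cons_col.

Let lebesgue_cons0 : lebesgue_cons set0 = 0%E.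
Proof. exact: measure0. Qed.

Let lebesgue_cons_ge0 A : (0 <= lebesgue_cons A)%E.
Proof. exact: measure_ge0. Qed.

Let lebesgue_cons_sigma_additive : semi_sigma_additive lebesgue_cons.
Proof. exact: measure_semi_sigma_additive. Qed.

HB.instance Definition _ := isMeasure.Build _ _ _ lebesgue_cons
  lebesgue_cons0 lebesgue_cons_ge0 lebesgue_cons_sigma_additive.

Let lebesgue_cons_sigma_finite : sigma_finite setT lebesgue_cons.
Proof.
have /sigma_finiteP[F [TF ndF Foo]] :=
  sigma_finiteT (@lebesgue_measure R : {sigma_finite_measure set _ -> \bar R}).
have /sigma_finiteP[G [TG ndG Goo]] := sigma_finiteT mu.
pose g (v : 'cV[R]_p.+1) : measurableTypeR R * 'cV[R]_p :=
  (v ord0 0, \col_j v (lift ord0 j) 0).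
have mg : measurable_fun setT g.
  apply/measurable_fun_pairP; split; first exact: measurable_coor.
  apply: measurable_fun_colP => j.
  rewrite [X in measurable_fun _ X](_ : _ =
    fun v : 'cV[R]_p.+1 => v (lift ord0 j) 0); first exact: measurable_coor.
  by apply/funext => v; rewrite mxE.
have gK : cancel cons_col g.
  move=> [x v]; rewrite /g /= mxE unlift_none /=; congr pair.
  by apply/colP => j; rewrite !mxE liftK.
exists (fun n => g @^-1` (F n `*` G n)).
  rewrite -preimage_bigcup (_ : \bigcup_i _ = setT) ?preimage_setT//.
  apply/seteqP; split => // -[x v] _.
  have [[m _ Fmx] [n _ Gnv]] : (\bigcup_n F n) x /\ (\bigcup_n G n) v.
    by rewrite -TF -TG.
  exists (maxn m n) => //; split.
    by move: x Fmx; exact/subsetPset/ndF/leq_maxl.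
  by move: v Gnv; exact/subsetPset/ndG/leq_maxr.
move=> n; have [mFn Fnoo] := Foo n; have [mGn Gnoo] := Goo n.
have mFG : measurable (F n `*` G n) by exact: measurableX.
split; first by rewrite -[X in measurable X]setTI; exact: mg.
rewrite /lebesgue_cons /pushforward -comp_preimage.
rewrite (_ : g \o cons_col = id); last by apply/funext => x; exact: gK.
by rewrite preimage_id product_measure1E// lte_mul_pinfty// ge0_fin_numE.
Qed.

HB.instance Definition _ := Measure_isSigmaFinite.Build _ _ _ lebesgue_cons
  lebesgue_cons_sigma_finite.

End lebesgue_cons.

Fixpoint lebesgue_col {R : realType} (p : nat) :
    {sigma_finite_measure set 'cV[R]_p -> \bar R} :=
  match p with
  | 0 => \d_(0 : 'cV[R]_0)
  | q.+1 => lebesgue_cons (lebesgue_col q)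
  end.

Section vectors.
Context {R : realType} (p : nat).
Implicit Types (u v x : 'cV[R]_p) (E : {vspace 'cV[R]_p}).

Definition dotv u v : R := (u^T *m v) 0 0.

(** The norm `|x| of the library is the sup norm, hence this definition. *)
Definition norm2 x : R := Num.sqrt (dotv x x).

Definition orth_projection E (M : 'M[R]_p) : Prop :=
  forall x, M *m x \in E /\ (forall y, y \in E -> dotv y (x - M *m x) = 0).

Definition posdef (S : 'M[R]_p) : Prop :=
  S^T = S /\ (forall x, x != 0 -> 0 < dotv x (S *m x)).

(** S = Sigma^{-1/2} *)
Definition inv_sqrt (Sigma S : 'M[R]_p) : Prop :=
  posdef S /\ S *m S = invmx Sigma.

End vectors.

(** The topological support of a measure; for a measure with a density, it
    depends only on the almost everywhere class of the density. *)
Definition support_of {R : realType} (T : topologicalType)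
    (mu : set T -> \bar R) : set T :=
  [set x | forall U, open U -> U x -> (0 < mu U)%E].

Definition boundary (T : topologicalType) (A : set T) : set T :=
  closure A `\` interior A.

Section probability_notions.
Context {d : measure_display} {T : measurableType d} {R : realType}.
Variable P : probability T R.

Definition mean_vec (p : nat) (V : T -> 'cV[R]_p) : 'cV[R]_p :=
  \col_i fine 'E_P[fun w => V w i 0].

Definition cov_mx (p : nat) (V : T -> 'cV[R]_p) : 'M[R]_p :=
  \matrix_(i, j) fine (covariance P (fun w => V w i 0) (fun w => V w j 0)).

Definition has_density (p : nat) (V : T -> 'cV[R]_p) : Prop :=
  exists f : 'cV[R]_p -> R, [/\ measurable_fun setT f, (forall x, 0 <= f x) &
    forall A, measurable A ->
      P (V @^-1` A) = (\int[lebesgue_col p]_(x in A) (f x)%:E)%E].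

(** W is a version of the conditional expectation E[V | G], for V integrable
    and G a sub-sigma-algebra of the ambient one. *)
Definition cond_exp (G : set (set T)) (V W : T -> R) : Prop :=
  [/\ forall B, measurable B -> G (W @^-1` B),
      P.-integrable setT (EFin \o W) &
      forall A, G A ->
        (\int[P]_(w in A) (W w)%:E = \int[P]_(w in A) (V w)%:E)%E].

Definition cond_exp_vec (p : nat) (G : set (set T))
    (V W : T -> 'cV[R]_p) : Prop :=
  forall i, cond_exp G (fun w => V w i 0) (fun w => W w i 0).

(** theta is a version of y |-> E[V | Y = y]. *)
Definition cond_exp_fun (Y : T -> R) (V : T -> R) (theta : R -> R) : Prop :=
  measurable_fun setT theta /\
  cond_exp (g_sigma_algebra_preimage Y) V (theta \o Y).

(** P(Y in A, Z in B | G) = P(Y in A | G) P(Z in B | G) almost surely. *)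
Definition cond_independent (p : nat) (G : set (set T)) (Y : T -> R)
    (Z : T -> 'cV[R]_p) : Prop :=
  forall (A : set R) (B : set 'cV[R]_p), measurable A -> measurable B ->
  exists f g : T -> R,
    [/\ cond_exp G \1_(Y @^-1` A) f, cond_exp G \1_(Z @^-1` B) g &
        cond_exp G \1_(Y @^-1` A `&` Z @^-1` B) (f \* g)].

Definition DRS (p : nat) (Y : T -> R) (Z : T -> 'cV[R]_p)
    (E : {vspace 'cV[R]_p}) : Prop :=
  exists M : 'M[R]_p, orth_projection E M /\
    cond_independent (g_sigma_algebra_preimage (fun w => M *m Z w)) Y Z.

Definition central_subspace (p : nat) (Y : T -> R) (Z : T -> 'cV[R]_p)
    (E : {vspace 'cV[R]_p}) : Prop :=
  [/\ DRS Y Z E,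
      forall F, DRS Y Z F -> (\dim E <= \dim F)%N,
      forall F, DRS Y Z F -> \dim F = \dim E -> F = E &
      forall x, x \in E <-> (forall F, DRS Y Z F -> x \in F)].

End probability_notions.

Section weighted_L1.
Context {R : realType}.
Variables (theta : R -> R) (mu : set R -> \bar R).

Definition L1_weighted : set (R -> R) :=
  [set u : R -> R | measurable_fun setT u /\
    (\int[mu]_y (`|u y| * theta y)%:E < +oo)%E].

(** The linear span of Psi is dense in L_1(theta(y) mu(dy)). *)
Definition total_in_L1 (Psi : set (R -> R)) : Prop :=
  Psi `<=` L1_weighted /\
  forall u, L1_weighted u -> forall e : R, 0 < e ->
  exists n (c : 'I_n -> R) (psi : 'I_n -> R -> R),
    (forall k, Psi (psi k)) /\
    (\int[mu]_y (`|u y - \sum_(k < n) c k * psi k y| * theta y)%:E < e%:E)%E.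

End weighted_L1.

(* Main.v *)
(** Write G for the sigma-algebra generated by [Pc Z].  Conditional independence
    and linearity give E[1_A(Y) Qc Z] = E[P(Y in A | G) Qc Z] = 0 for every Borel
    set A, so E[psi(Y) Qc Z] = 0, i.e., E[psi(Y) Z] is in Ec, for all psi in L_1.
    Conversely, if eta in Ec is orthogonal to E[psi(Y) Z] for all psi in Psi,
    then E[u(Y) eta^T Z] = 0 for all u in L_1: approximating u by s in the span
    of Psi costs at most a constant times E[|u - s|(Y) E[|Z| | Y]].  Taking
    indicator functions for u gives E[eta^T Z | Y] = 0 almost surely, so eta = 0
    by coverage.  Hence the vectors E[psi(Y) Z] span Ec. *)

Require Import Defs.
From HB Require Import structures.
From mathcomp Require Import all_boot all_order all_algebra finmap.
From mathcomp Require Import all_classical all_reals all_analysis.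
From mathcomp Require Import measurable_realfun.

Set Implicit Arguments.
Unset Strict Implicit.
Unset Printing Implicit Defensive.

Import Order.TTheory GRing.Theory Num.Theory numFieldNormedType.Exports.

Local Open Scope classical_set_scope.
Local Open Scope ring_scope.

(** * Pulling a function of Y out of an integral *)

(** Splits the positive part of a product into products of positive and negative parts; applied to
    [a] and [- b], it also splits the negative part. *)
Lemma maxrM0 (R : realDomainType) (a b : R) :
  Num.max (a * b) 0 =
  Num.max a 0 * Num.max b 0 + Num.max (- a) 0 * Num.max (- b) 0.
Proof.
have [a0|a0] := orP (le_total 0 a); have [b0|b0] := orP (le_total 0 b).
- by rewrite (@max_r _ _ (- a)) ?oppr_le0// mul0r addr0 (@max_l _ _ a)//
    (@max_l _ _ b)// max_l ?mulr_ge0.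
- rewrite (@max_r _ _ (- a)) ?oppr_le0// (@max_r _ _ b)// mulr0 mul0r addr0.
  by rewrite max_r// mulr_ge0_le0.
- rewrite (@max_r _ _ (- b)) ?oppr_le0// (@max_r _ _ a)// mulr0 mul0r addr0.
  by rewrite max_r// mulr_le0_ge0.
- rewrite (@max_r _ _ a)// mul0r add0r.
  by rewrite !max_l ?oppr_ge0 ?mulr_le0// mulrNN.
Qed.

Section pull_out.
Context d d' (T : measurableType d) (T' : measurableType d') (R : realType).
Variables (mu : {measure set T -> \bar R}) (Y : T -> T').
Hypothesis mY : measurable_fun setT Y.

Import HBNNSimple.

Let mpreimage B : measurable B -> measurable (Y @^-1` B).
Proof. by move=> mB; rewrite -[X in measurable X]setTI; exact: mY. Qed.

Let integral_comp_approx (h : T -> R) (v : T' -> R)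
    (mv : measurable_fun [set: T'] (EFin \o v)) :
  measurable_fun setT h -> (forall x, 0 <= h x) -> (forall y, 0 <= v y) ->
  (\int[mu]_x (v (Y x) * h x)%:E = limn (fun n =>
    let s := nnsfun_approx measurableT mv n in
    \sum_(r \in range s) (r%:E *
      \int[mu]_(x in Y @^-1` (s @^-1` [set r])) (h x)%:E)))%E.
Proof.
move=> mh h0 v0; pose s := nnsfun_approx measurableT mv.
have mYs n : measurable_fun setT (fun x => s n (Y x)).
  by apply: measurableT_comp mY; exact: measurable_funP.
(* Monotone convergence: since [h] is nonnegative, the products increase with [n]. *)
transitivity (limn (fun n => \int[mu]_x ((s n (Y x))%:E * (h x)%:E)))%E.
  rewrite -monotone_convergence//=.
  - apply: eq_integral => x _; apply/esym/cvg_lim => //.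
    rewrite EFinM; apply: cvgeZr => //.
    have f0 y : setT y -> (0 <= (EFin \o v) y)%E by rewrite /= lee_fin.
    exact: (@cvg_nnsfun_approx _ _ _ _ measurableT _ mv f0 (Y x)).
  - by move=> n; apply: emeasurable_funM; exact/measurable_EFinP.
  - by move=> n x _; rewrite mule_ge0// lee_fin.
  - move=> x _ a b ab; rewrite lee_wpmul2r ?lee_fin//.
    exact/lefP/nd_nnsfun_approx.
congr (limn _); apply/funext => n; rewrite -/(s n).
have e x : ((s n (Y x))%:E * (h x)%:E = \sum_(r \in range (s n))
    (r * \1_(s n @^-1` [set r]) (Y x))%:E * (h x)%:E)%E.
  rewrite -ge0_mule_fsuml => [|y]; last exact: nnfun_muleindic_ge0.
  by rewrite fsumEFin// -fimfunE.
under eq_integral do rewrite e.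
have mi r : measurable_fun setT (fun x => \1_(s n @^-1` [set r]) (Y x) : R).
  by apply: measurableT_comp mY; exact: measurable_indic.
rewrite ge0_integral_fsum//; last 2 first.
- move=> r; apply: emeasurable_funM; apply/measurable_EFinP => //.
  by apply: measurable_funM.
- by move=> r x _; rewrite mule_ge0 ?lee_fin// -lee_fin EFinM nnfun_muleindic_ge0.
apply: eq_fsbigr => r /[!inE] -[y _ <-].
under eq_integral do rewrite EFinM -muleA.
rewrite ge0_integralZl//.
- congr (_ * _)%E; rewrite [RHS]integral_mkcond epatch_indic.
  by apply: eq_integral => x _; rewrite /= muleC !indicE.
- by apply: emeasurable_funM; exact/measurable_EFinP.
- by move=> x _; rewrite mule_ge0 ?lee_fin.
- by rewrite lee_fin.
Qed.

(** The common value may be infinite, so the lemma can also be used to prove integrability. *)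
Lemma pull_out_ge0 (h1 h2 : T -> R) (v : T' -> R) :
    measurable_fun setT h1 -> measurable_fun setT h2 ->
    measurable_fun setT v ->
    (forall x, 0 <= h1 x) -> (forall x, 0 <= h2 x) -> (forall y, 0 <= v y) ->
    (forall B, measurable B ->
      \int[mu]_(x in Y @^-1` B) (h1 x)%:E =
      \int[mu]_(x in Y @^-1` B) (h2 x)%:E)%E ->
  (\int[mu]_x (v (Y x) * h1 x)%:E = \int[mu]_x (v (Y x) * h2 x)%:E)%E.
Proof.
move=> mh1 mh2 mv h10 h20 v0 h12.
have mv' : measurable_fun [set: T'] (EFin \o v) by exact/measurable_EFinP.
rewrite !(integral_comp_approx mv')//=; congr (limn _); apply/funext => n.
by apply: eq_fsbigr => r _; rewrite h12.
Qed.

Lemma pull_out (D : T -> R) (v : T' -> R) :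
    mu.-integrable setT (EFin \o D) -> measurable_fun setT v ->
    mu.-integrable setT (fun x => (v (Y x) * D x)%:E) ->
    (forall B, measurable B -> \int[mu]_(x in Y @^-1` B) (D x)%:E = 0)%E ->
  (\int[mu]_x (v (Y x) * D x)%:E = 0)%E.
Proof.
move=> iD mv ivD D0.
have mD : measurable_fun setT D by exact/measurable_EFinP/(measurable_int mu).
have Dpn B : measurable B -> (\int[mu]_(x in Y @^-1` B) (D^\+ x)%:E =
    \int[mu]_(x in Y @^-1` B) (D^\- x)%:E)%E.
  move=> mB; have mYB := mpreimage mB.
  have iDB : mu.-integrable (Y @^-1` B) (EFin \o D) by apply: integrableS iD.
  have ip := integrable_funrpos mYB iDB; have im := integrable_funrneg mYB iDB.
  have := D0 _ mB; under eq_integral => x _.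
    rewrite (_ : D x = D^\+ x - D^\- x); last first.
      by rewrite -[LHS](congr1 (@^~ x) (funrposBneg D)).
    rewrite EFinB; over.
  rewrite integralB_EFin//.
  rewrite -(fineK (integrable_fin_num mYB ip)).
  rewrite -(fineK (integrable_fin_num mYB im)).
  by rewrite -EFinB => -[] /eqP; rewrite subr_eq0 => /eqP ->.
have mp := measurable_funrpos mD; have mn := measurable_funrneg mD.
have mvp := measurable_funrpos mv; have mvn := measurable_funrneg mv.
have Ep := @pull_out_ge0 _ _ _ mp mn mvp.
have En := @pull_out_ge0 _ _ _ mp mn mvn.
rewrite integralE.
have posE x : ((fun x => (v (Y x) * D x)%:E)^\+ x =
    (v^\+ (Y x) * D^\+ x)%:E + (v^\- (Y x) * D^\- x)%:E)%E.
  by rewrite funeposE -EFin_max maxrM0 EFinD.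
have negE x : ((fun x => (v (Y x) * D x)%:E)^\- x =
    (v^\+ (Y x) * D^\- x)%:E + (v^\- (Y x) * D^\+ x)%:E)%E.
  by rewrite funenegE -EFinN -mulrN -EFin_max maxrM0 opprK EFinD.
(* Finiteness excludes a difference of two infinite integrals. *)
have negfin : (\int[mu]_x (fun x => (v (Y x) * D x)%:E)^\- x)%E \is a fin_num.
  exact: integrable_neg_fin_num.
suff -> : (\int[mu]_x (fun x => (v (Y x) * D x)%:E)^\+ x =
   \int[mu]_x (fun x => (v (Y x) * D x)%:E)^\- x)%E by rewrite subee.
under eq_integral do rewrite posE.
under [RHS]eq_integral do rewrite negE.
have mM (f : T' -> R) (g : T -> R) :
    measurable_fun setT f -> measurable_fun setT g ->
    measurable_fun setT (fun x => (f (Y x) * g x)%:E).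
  move=> mf mg; apply/measurable_EFinP/measurable_funM => //.
  exact: measurableT_comp mf mY.
rewrite !ge0_integralD//;
  try (by move=> x _; rewrite lee_fin mulr_ge0); try exact: mM.
by rewrite Ep// En.
Qed.
End pull_out.

(** * Conditional expectation and conditional independence *)

(** On the event where [f] is negative, its integral is minus that of its absolute value, so the
    hypothesis forces both to vanish. *)
Lemma ae_ge0_integral d (T : measurableType d) (R : realType)
    (mu : {measure set T -> \bar R}) (f : T -> R) :
    measurable_fun setT f ->
    (0 <= \int[mu]_(x in f @^-1` `]-oo, 0%R[%classic) (f x)%:E)%E ->
  {ae mu, forall x, 0 <= f x}.
Proof.
move=> mf; set A := _ @^-1` _ => f0.
have mA : measurable A by rewrite -[A]setTI; apply: mf => //; exact: measurable_itv.
have AE x : A x = (f x < 0) by rewrite /A/= in_itv.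
have fA x : x \in A -> f x <= 0 by rewrite inE AE => /ltW.
have : (\int[mu]_(x in A) `|(f x)%:E| = 0)%E.
  apply/eqP; rewrite eq_le integral_ge0// andbT.
  have e : (\int[mu]_(x in A) (f x)%:E = - \int[mu]_(x in A) `|(f x)%:E|)%E.
    rewrite -integral_ge0N//.
    by apply: eq_integral => x /fA fx; rewrite lee0_abs ?oppeK// lee_fin.
  by move: f0; rewrite e leeNr oppe0.
have mfA : measurable_fun A (EFin \o f).
  by apply/measurable_EFinP; exact: measurable_funTS.
move=> /(ae_eq_integral_abs mu mA mfA).
apply: filterS => x /= xA; rewrite leNgt; apply/negP => fx.
by move: xA; rewrite AE => /(_ fx) [fx0]; move: fx; rewrite fx0 ltxx.
Qed.

Section cond_exp_lemmas.
Context d d' (T : measurableType d) (T' : measurableType d') (R : realType).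
Variables (P : probability T R) (U : T -> T').
Hypothesis mU : measurable_fun setT U.
Let G := g_sigma_algebra_preimage U.

Lemma g_sigma_algebra_preimage_measurable A : G A -> measurable A.
Proof. by case=> B mB <-; exact: mU. Qed.

Lemma measurable_fun_g_sigma_algebra_preimageP d'' (T'' : measurableType d'')
    (f : T -> T'') :
  (forall B, measurable B -> G (f @^-1` B)) <->
  measurable_fun [set: g_sigma_algebra_preimageType U] f.
Proof.
split=> [Gf _ B mB|mf B mB]; first by rewrite setTI; exact: Gf.
by rewrite -[f @^-1` B]setTI; exact: mf.
Qed.

Lemma measurable_id_g_sigma_algebra_preimage :
  measurable_fun [set: T] (id : T -> g_sigma_algebra_preimageType U).
Proof.
by move=> _ B mB; rewrite setTI; exact: g_sigma_algebra_preimage_measurable.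
Qed.

Lemma cond_exp_le (V1 V2 W1 W2 : T -> R) :
    cond_exp P G V1 W1 -> cond_exp P G V2 W2 ->
    (forall A, G A ->
      \int[P]_(w in A) (V1 w)%:E <= \int[P]_(w in A) (V2 w)%:E)%E ->
  {ae P, forall w, W1 w <= W2 w}.
Proof.
move=> [GW1 iW1 E1] [GW2 iW2 E2] V12.
have mW1 : measurable_fun setT W1 by exact/measurable_EFinP/(measurable_int P).
have mW2 : measurable_fun setT W2 by exact/measurable_EFinP/(measurable_int P).
suff : {ae P, forall w, 0 <= W2 w - W1 w}.
  by apply: filterS => w; rewrite subr_ge0.
apply: ae_ge0_integral; first exact: measurable_funB.
set A := _ @^-1` _.
(* The event where [W2 < W1] lies in [G] because both versions are measurable for [G]; the defining
   identities apply to it. *)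
have GA : G A.
  apply: (measurable_fun_g_sigma_algebra_preimageP _).2 (measurable_itv _).
  by apply: measurable_funB; apply/measurable_fun_g_sigma_algebra_preimageP.
have mA := g_sigma_algebra_preimage_measurable GA.
under eq_integral do rewrite EFinB.
have iW1A : P.-integrable A (EFin \o W1) by exact: integrableS iW1.
have iW2A : P.-integrable A (EFin \o W2) by exact: integrableS iW2.
rewrite integralB_EFin// sube_ge0 ?integrable_fin_num//.
by rewrite E1// E2// V12.
Qed.

Lemma cond_exp_ae_eq (V W1 W2 : T -> R) :
  cond_exp P G V W1 -> cond_exp P G V W2 -> {ae P, forall w, W1 w = W2 w}.
Proof.
move=> h1 h2; have W12 := cond_exp_le h1 h2 (fun _ _ => lexx _).
have W21 := cond_exp_le h2 h1 (fun _ _ => lexx _).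
by move: W12 W21; apply: filterS2 => w le12 le21; apply/eqP; rewrite eq_le le12.
Qed.

(** Here [pull_out] is applied to the identity, viewed as a map into [T] endowed
    with the coarser sigma-algebra. *)
Lemma cond_exp_pull_out (V : T -> R) (v : T -> R) :
    P.-integrable setT (EFin \o V) ->
    (forall B, measurable B -> G (v @^-1` B)) ->
    P.-integrable setT (fun x => (v x * V x)%:E) ->
    (forall A, G A -> \int[P]_(x in A) (V x)%:E = 0)%E ->
  (\int[P]_x (v x * V x)%:E = 0)%E.
Proof.
move=> iV /measurable_fun_g_sigma_algebra_preimageP mv ivV V0.
exact: (pull_out measurable_id_g_sigma_algebra_preimage).
Qed.

(** With f = P(Y in A | G), conditional independence says that 1_A(Y) and f have
    the same integral over every event [Z^-1 B]; thus E[1_A(Y) h(Z)] = E[f h(Z)],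
    which vanishes because f is G-measurable.  The version of f provided by
    [cond_independent] depends on B, whence the almost sure comparison. *)
Lemma cond_independent_integral0 (p : nat) (Y : T -> R) (Z : T -> 'cV[R]_p)
    (h : 'cV[R]_p -> R) :
    measurable_fun setT Y -> measurable_fun setT Z -> measurable_fun setT h ->
    P.-integrable setT (EFin \o (h \o Z)) ->
    cond_independent P G Y Z ->
    (forall A, G A -> \int[P]_(w in A) (h (Z w))%:E = 0)%E ->
  forall A, measurable A -> (\int[P]_(w in Y @^-1` A) (h (Z w))%:E = 0)%E.
Proof.
move=> mY mZ mh ihZ YZ hZ0 A mA.
have mYA : measurable (Y @^-1` A) by rewrite -[X in measurable X]setTI; exact: mY.
have mZB B : measurable B -> measurable (Z @^-1` B).
  by move=> mB; rewrite -[X in measurable X]setTI; exact: mZ.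
have iI B : measurable B -> P.-integrable setT (EFin \o (\1_B : T -> R)).
  by move=> mB; exact: integrable_indic.
have [f [_ [hf _ _]]] := YZ A setT mA measurableT.
have [Gf iF Ef] := hf.
have mf : measurable_fun setT f by exact/measurable_EFinP/(measurable_int P).
have f0 : {ae P, forall w, 0 <= f w}.
  have h0 : cond_exp P G (cst 0) (cst 0).
    split => //; last exact: integrable0.
    by apply/measurable_fun_g_sigma_algebra_preimageP; exact: measurable_cst.
  apply: (cond_exp_le h0 hf) => B GB; rewrite integral0.
  by apply: integral_ge0 => w _; rewrite lee_fin indicE ler0n.
have iB (g1 g2 : T -> R) : P.-integrable setT (EFin \o g1) ->
    P.-integrable setT (EFin \o g2) ->
    P.-integrable setT (fun w => (g1 w - g2 w)%:E).
  by move=> i1 i2; exact: (integrableB measurableT i1 i2).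
have iM1 (g : T -> R) B : measurable B -> P.-integrable setT (EFin \o g) ->
    P.-integrable setT (fun w => (g w * \1_B w)%:E).
  move=> mB ig; apply: (le_integrable measurableT _ _ ig).
    apply/measurable_EFinP/measurable_funM; last exact: measurable_indic.
    exact/measurable_EFinP/(measurable_int P).
  move=> w _; rewrite /= lee_fin normrM indicE.
  by rewrite ler_piMr// normr_nat lern1 leq_b1.
(* E[1_A(Y) 1_B(Z)] = E[fB gB] = E[fB 1_B(Z)] = E[f 1_B(Z)]: conditional independence, then
   measurability of [fB] for [G], then almost sure equality of versions. *)
have EfZ B : measurable B ->
    (\int[P]_(w in Z @^-1` B) (\1_(Y @^-1` A) w - f w)%:E = 0)%E.
  move=> mB; have [fB [gB [hfB hgB hfg]]] := YZ A B mA mB.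
  have [GfB ifB EfB] := hfB; have [GgB igB EgB] := hgB; have [_ ifg Efg] := hfg.
  have mfB : measurable_fun setT fB by exact/measurable_EFinP/(measurable_int P).
  have GT : G setT by exists setT => //; rewrite preimage_setT setTI.
  have mB' := mZB _ mB.
  have iD (g : T -> R) C : measurable C -> P.-integrable setT (EFin \o g) ->
    P.-integrable C (EFin \o g) by move=> mC; exact: integrableS.
  under eq_integral do rewrite EFinB.
  rewrite integralB_EFin//; [|exact: iD (iI _ _)|exact: iD].
  have c0 : (\int[P]_w (fB w * (gB w - \1_(Z @^-1` B) w))%:E = 0)%E.
    apply: cond_exp_pull_out => //.
    - by apply: iB => //; exact: iI.
    - under eq_fun do rewrite mulrBr.
      by apply: (iB (fB \* gB)) => //; exact: iM1.
    - move=> C GC; have mC := g_sigma_algebra_preimage_measurable GC.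
      under eq_integral do rewrite EFinB.
      rewrite integralB_EFin//; [|exact: iD|exact: iD (iI _ _)].
      rewrite EgB// subee// integrable_fin_num//.
      exact: iD (iI _ _).
  rewrite -{}c0; under [RHS]eq_integral do rewrite mulrBr EFinB.
  rewrite [RHS](@integralB_EFin _ _ _ _ _ (fB \* gB))//; last exact: iM1.
  have -> : (\int[P]_w ((fB \* gB) w)%:E =
      \int[P]_(w in Z @^-1` B) (\1_(Y @^-1` A) w)%:E)%E.
    by rewrite Efg// !integral_indic//; [rewrite setIT|exact: measurableI].
  have -> : (\int[P]_w (fB w * \1_(Z @^-1` B) w)%:E =
      \int[P]_(w in Z @^-1` B) (f w)%:E)%E; last by [].
    transitivity (\int[P]_(w in Z @^-1` B) (fB w)%:E)%E.
      by rewrite [RHS]integral_mkcond epatch_indic.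
    apply: ae_eq_integral => //; [exact/measurable_EFinP/measurable_funTS..|].
    by apply: filterS (cond_exp_ae_eq hfB hf) => w + _; move=> /= ->.
have mhZ : measurable_fun setT (h \o Z) by exact: measurableT_comp.
have iAf : P.-integrable setT (EFin \o (fun w => \1_(Y @^-1` A) w - f w)).
  by apply: iB => //; exact: iI.
have ih1 := iM1 _ _ mYA ihZ.
(* As [f] is nonnegative almost surely, [pull_out_ge0] equates E[|h(Z)| |f|] with E[|h(Z)| 1_A(Y)],
   which is finite. *)
have ifhZ : P.-integrable setT (fun w => (h (Z w) * f w)%:E).
  apply/integrableP; split; first exact/measurable_EFinP/measurable_funM.
  have E B : measurable B -> (\int[P]_(w in Z @^-1` B) (`|f w|)%:E =
      \int[P]_(w in Z @^-1` B) (\1_(Y @^-1` A) w)%:E)%E.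
    move=> mB; have mB' := mZB _ mB.
    transitivity (\int[P]_(w in Z @^-1` B) (f w)%:E)%E.
      apply: ae_eq_integral => //.
      - by apply/measurable_EFinP/measurable_funTS; exact: measurableT_comp.
      - exact/measurable_EFinP/measurable_funTS.
      by apply: filterS f0 => w fw _ /=; rewrite ger0_norm.
    have iBg (g : T -> R) : P.-integrable setT (EFin \o g) ->
      P.-integrable (Z @^-1` B) (EFin \o g) by exact: integrableS.
    have := EfZ B mB; under eq_integral do rewrite EFinB.
    have i1 := iBg _ (iI _ mYA); have i2 := iBg _ iF.
    rewrite integralB_EFin// -(fineK (integrable_fin_num mB' i1)).
    rewrite -(fineK (integrable_fin_num mB' i2)) -EFinB => -[] /eqP.
    by rewrite subr_eq0 => /eqP ->.
  have -> : (\int[P]_w `|(h (Z w) * f w)%:E| =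
      \int[P]_w (`|h (Z w)| * \1_(Y @^-1` A) w)%:E)%E.
    under eq_integral do rewrite abse_EFin normrM.
    apply: (pull_out_ge0 mZ (v := fun z => `|h z|)) => //.
    - exact: measurableT_comp.
    - exact: measurableT_comp.
  have /integrableP[_] := ih1; congr (_ < _)%E.
  by apply: eq_integral => w _; rewrite abse_EFin normrM indicE normr_nat.
(* Here the factor pulled out is [h], a function of [Z]; in [E2] it is [f], measurable for [G]. *)
have E1 : (\int[P]_w (h (Z w) * (\1_(Y @^-1` A) w - f w))%:E = 0)%E.
  apply: (pull_out mZ) => //.
  under eq_fun do rewrite mulrBr.
  exact: (iB (fun w => h (Z w) * \1_(Y @^-1` A) w)).
have E2 : (\int[P]_w (h (Z w) * f w)%:E = 0)%E.
  under eq_integral do rewrite mulrC.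
  apply: cond_exp_pull_out => //.
  by apply: eq_integrable ifhZ => // w _; rewrite /= mulrC.
rewrite -{}E1; under [RHS]eq_integral do rewrite mulrBr EFinB.
rewrite [RHS](@integralB_EFin _ _ _ _ _ (fun w => h (Z w) * \1_(Y @^-1` A) w))//.
by rewrite E2 sube0 [LHS]integral_mkcond epatch_indic.
Qed.
End cond_exp_lemmas.

(** * Linear algebra: finite spanning families, orthogonality, projections *)

(** Take a finite subset whose span has maximal dimension: adding one more index cannot enlarge that
    span. *)
Lemma finite_span (K : fieldType) (vT : vectType K) (I : choiceType)
    (A : set I) (m : I -> vT) :
  exists F : set I, [/\ F `<=` A, finite_set F &
    forall i, A i -> m i \in <<[seq m j | j <- fset_set F]>>%VS].
Proof.
pose sp (F : set I) := <<[seq m j | j <- fset_set F]>>%VS.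
pose Q n := `[< exists F, [/\ F `<=` A, finite_set F & \dim (sp F) = n] >].
have Q0 : exists n, Q n.
  by exists (\dim (sp set0)); apply/asboolP; exists set0; split.
have Qle n : Q n -> (n <= \dim (fullv : {vspace vT}))%N.
  by move=> /asboolP[F [_ _ <-]]; exact/dimvS/subvf.
case: (ex_maxnP Q0 Qle) => n /asboolP[F [FA finF dimF]] maxn.
exists F; split=> // i Ai; rewrite -/(sp F).
have finG : finite_set (i |` F) by rewrite finite_setU; split.
have FG : (sp F <= sp (i |` F))%VS.
  apply: sub_span => _ /mapP[j jF ->]; apply: map_f.
  by move: jF; rewrite !in_fset_set// !inE => jF; right.
have -> : sp F = sp (i |` F).
  apply/eqP; rewrite eqEdim FG dimF maxn//; apply/asboolP; exists (i |` F).
  by split=> // j [->|/FA].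
by apply/memv_span/map_f; rewrite in_fset_set// inE; left.
Qed.

Section vectors.
Context (R : realType) (p : nat).
Implicit Types (u v x : 'cV[R]_p) (E : {vspace 'cV[R]_p}).

Lemma dotvE u v : dotv u v = \sum_i u i 0 * v i 0.
Proof. by rewrite /dotv mxE; apply: eq_bigr => i _; rewrite mxE. Qed.

Lemma dotv0P v : dotv v v = 0 -> v = 0.
Proof.
rewrite dotvE => /eqP; rewrite psumr_eq0 => [/allP v0|i _]; last exact: sqr_ge0.
apply/colP => i; rewrite mxE; apply/eqP.
by rewrite -sqrf_eq0 expr2; apply: (implyP (v0 i (mem_index_enum i))).
Qed.

Lemma coor_le_norm2 v i : `|v i 0| <= norm2 v.
Proof.
rewrite -sqrtr_sqr /norm2 ler_wsqrtr// dotvE (bigD1 i)//= -expr2 lerDl.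
by apply: sumr_ge0 => j _; exact: sqr_ge0.
Qed.

(** A crude Cauchy-Schwarz inequality, with the l1 norm of [u]; any constant depending only on [u]
    suffices below. *)
Lemma dotv_le_norm2 u v : `|dotv u v| <= (\sum_i `|u i 0|) * norm2 v.
Proof.
rewrite dotvE mulr_suml; apply: le_trans (ler_norm_sum _ _ _) _.
by apply: ler_sum => i _; rewrite normrM ler_wpM2l// coor_le_norm2.
Qed.

Lemma measurable_dotv u : measurable_fun [set: 'cV[R]_p] (dotv u).
Proof.
rewrite (_ : dotv u = fun v => \sum_i u i 0 * v i 0); last exact/funext/dotvE.
by apply: measurable_sum => i; apply: measurable_funM => //; exact: measurable_coor.
Qed.

Lemma measurable_norm2 : measurable_fun [set: 'cV[R]_p] (@norm2 R p).
Proof.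
rewrite (_ : @norm2 R p = Num.sqrt \o (fun v => \sum_i v i 0 * v i 0)); last first.
  by apply/funext => v; rewrite /norm2 dotvE.
apply: measurableT_comp.
  by apply: continuous_measurable_fun; exact: sqrt_continuous.
by apply: measurable_sum => i; apply: measurable_funM; exact: measurable_coor.
Qed.

(** The difference of two projections of [x] lies in [E] and is also a difference of residuals
    orthogonal to [E], hence is orthogonal to itself. *)
Lemma orth_projection_uniq E (M N : 'M[R]_p) :
  orth_projection E M -> orth_projection E N -> M = N.
Proof.
move=> hM hN.
suff MN x : M *m x = N *m x.
  apply/matrixP => i j; have /colP/(_ i) := MN (delta_mx j 0).
  by rewrite -!colE !mxE.
have [[Mx oM] [Nx oN]] := (hM x, hN x).
apply/eqP; rewrite -subr_eq0; apply/eqP/dotv0P.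
have d : M *m x - N *m x \in E by exact: memvB.
rewrite [X in dotv _ X](_ : _ = (x - N *m x) - (x - M *m x)); last first.
  by rewrite opprB [RHS]addrC addrA subrK.
by rewrite /dotv mulmxBr mxE -/(dotv _ _) oN// mxE -/(dotv _ _) oM// subr0.
Qed.

Lemma exists_orthogonal (E W : {vspace 'cV[R]_p}) : (\dim W < \dim E)%N ->
  exists eta, [/\ eta \in E, eta != 0 & forall w, w \in W -> dotv eta w = 0].
Proof.
(* The rows of [M] are a basis of [W], so its kernel is the orthogonal complement of [W]. *)
move=> WE; pose M := \matrix_(k < \dim W, j < p) (vbasis W)`_k j 0.
pose f := linfun (mulmx M : 'cV_p -> 'cV_(\dim W)).
pose eta := vpick (E :&: lker f)%VS.
have : eta \in (E :&: lker f)%VS by exact: memv_pick.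
rewrite memv_cap memv_ker => /andP[etaE /eqP]; rewrite lfunE/= => Meta.
exists eta; split=> //.
  (* If the kernel met [E] trivially, the image of [E] would have dimension [\dim E], exceeding that
     of the target space. *)
  rewrite vpick0; apply/negP => /eqP K0; have := limg_ker_dim f E.
  rewrite K0 dimv0 add0n => /eqP; rewrite eqn_leq => /andP[_].
  rewrite leqNgt => /negP; apply; apply: leq_ltn_trans WE.
  apply: leq_trans (dimvS (subvf _)) _; rewrite dimvf /=.
  by rewrite /dim/= muln1.
move=> w /coord_vbasis ->.
have dotvb (k : 'I_(\dim W)) : dotv eta (vbasis W)`_k = 0.
  have := congr1 (fun v : 'cV_(\dim W) => v k 0) Meta; rewrite !mxE => <-.
  by rewrite dotvE; apply: eq_bigr => j _; rewrite mxE mulrC.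
rewrite /dotv mulmx_sumr summxE big1// => k _.
by rewrite -scalemxAr mxE -/(dotv _ _) dotvb mulr0.
Qed.

End vectors.

(** * Integrals of linear forms, mean vectors and variance *)

Section integral_dotv.
Context d (T : measurableType d) (R : realType).
Variables (mu : {measure set T -> \bar R}) (D : set T) (p : nat).
Variables (V : T -> 'cV[R]_p) (q : 'cV[R]_p).
Hypotheses (mD : measurable D)
  (iV : forall i, mu.-integrable D (fun w => (V w i 0)%:E)).

Let dotvV w : ((dotv q (V w))%:E = \sum_i (q i 0)%:E * (V w i 0)%:E)%E.
Proof. by rewrite dotvE -sumEFin. Qed.

Lemma integrable_dotv : mu.-integrable D (fun w => (dotv q (V w))%:E).
Proof.
under eq_fun do rewrite dotvV.
by apply: integrable_sum => // i _; exact: integrableZl.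
Qed.

Lemma integral_dotv : (\int[mu]_(w in D) (dotv q (V w))%:E =
  \sum_i (q i 0)%:E * \int[mu]_(w in D) (V w i 0)%:E)%E.
Proof.
under eq_integral do rewrite dotvV.
rewrite integral_sum//; last by move=> i; exact: integrableZl.
by apply: eq_bigr => i _; rewrite integralZl.
Qed.

End integral_dotv.

(** Integrability makes the coordinate expectations finite, so the [fine] in [mean_vec] loses
    nothing. *)
Lemma dotv_mean_vec d (T : measurableType d) (R : realType)
    (P : probability T R) (p : nat) (V : T -> 'cV[R]_p) (q : 'cV[R]_p) :
    (forall i, P.-integrable setT (fun w => (V w i 0)%:E)) ->
  ((dotv q (mean_vec P V))%:E = \int[P]_w (dotv q (V w))%:E)%E.
Proof.
move=> iV; rewrite integral_dotv// dotvE -sumEFin.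
apply: eq_bigr => i _; rewrite mxE unlock EFinM fineK//.
exact: integrable_fin_num.
Qed.

(** Supplies the contradiction with the coverage hypothesis. *)
Lemma variance_ae_eq0 d (T : measurableType d) (R : realType)
    (P : probability T R) (m : T -> R) :
  measurable_fun setT m -> {ae P, forall w, m w = 0} -> ('V_P[m] = 0)%E.
Proof.
move=> mm m0.
have Em : ('E_P[m] = 0)%E.
  rewrite unlock -(integral0 P setT); apply: ae_eq_integral => //.
  - exact/measurable_EFinP.
  - by apply: filterS m0 => w + _ => ->.
rewrite /variance unlock Em/= unlock -(integral0 P setT).
apply: ae_eq_integral => //.
  apply/measurable_EFinP; apply: measurable_funM; exact: measurable_funB.
apply: filterS m0 => w mw _; rewrite /= !fctE /=. by rewrite mw subrr mulr0.
Qed.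

(** * The weighted L1 space and the linear forms u -> E[u(Y) q^T Z] *)

Section weighted.
Context d (T : measurableType d) (R : realType) (P : probability T R) (p : nat).
Variables (Y : {RV P >-> R}) (Z : T -> 'cV[R]_p) (theta : R -> R).
Hypotheses (mZ : measurable_fun setT Z) (theta_ge0 : forall y, 0 <= theta y)
  (htheta : cond_exp_fun P Y (fun w => norm2 (Z w)) theta).

Let mY : measurable_fun [set: T] Y. Proof. exact: measurable_funP. Qed.

Let mtheta : measurable_fun setT theta. Proof. by case: htheta. Qed.

Let mnormZ : measurable_fun setT (fun w => norm2 (Z w)).
Proof. by apply: measurableT_comp mZ; exact: measurable_norm2. Qed.

(** [norm2 (Z w)] and [theta (Y w)] have the same integrals over the events of [Y]; pulling out
    |u(Y)| and changing variables turns the weighted norm into a moment of [Z]. *)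
Lemma integral_norm2_weighted (u : R -> R) : measurable_fun setT u ->
  (\int[P]_w (`|u (Y w)| * norm2 (Z w))%:E =
   \int[distribution P Y]_y (`|u y| * theta y)%:E)%E.
Proof.
move=> mu; have [_ [_ _ Etheta]] := htheta.
rewrite (ge0_integral_distribution Y (f := fun y => (`|u y| * theta y)%:E)).
- apply: (pull_out_ge0 mY (v := fun y => `|u y|)) => //.
  + exact: measurableT_comp.
  + exact: measurableT_comp.
  + by move=> w; exact: sqrtr_ge0.
  + move=> B mB; rewrite [RHS]Etheta//.
    by exists B => //; rewrite setTI.
- by apply/measurable_EFinP/measurable_funM => //; exact: measurableT_comp.
- by move=> y; rewrite lee_fin mulr_ge0.
Qed.

(** An indicator is at most 1, and [theta \o Y] is integrable as a conditional expectation. *)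
Lemma L1_weighted_indic B : measurable B ->
  L1_weighted theta (distribution P Y) \1_B.
Proof.
move=> mB; split; first exact: measurable_indic.
have [_ [_ itheta _]] := htheta.
apply: le_lt_trans (integrable_lty measurableT itheta).
rewrite -(ge0_integral_distribution Y (f := fun y => (theta y)%:E)).
- apply: ge0_le_integral => //.
  + by move=> y _; rewrite lee_fin mulr_ge0.
  + apply/measurable_EFinP/measurable_funM => //.
    by apply: measurableT_comp => //; exact: measurable_indic.
  + exact/measurable_EFinP.
  + by move=> y _; rewrite lee_fin indicE normr_nat ler_piMl// lern1 leq_b1.
- exact/measurable_EFinP.
- by move=> y; rewrite lee_fin.
Qed.

Let measurable_u_dotv (u : R -> R) (q : 'cV[R]_p) : measurable_fun setT u ->
  measurable_fun setT (fun w => u (Y w) * dotv q (Z w)).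
Proof.
move=> mu; apply: measurable_funM; first exact: measurableT_comp.
by apply: measurableT_comp mZ; exact: measurable_dotv.
Qed.

(** This is the continuity of the form u -> E[u(Y) q^T Z] for the weighted norm. *)
Lemma integral_norm_dotv_le (u : R -> R) (q : 'cV[R]_p) :
    measurable_fun setT u ->
  (\int[P]_w `|(u (Y w) * dotv q (Z w))%:E| <= (\sum_i `|q i 0|)%:E *
    \int[distribution P Y]_y (`|u y| * theta y)%:E)%E.
Proof.
move=> mu; rewrite -integral_norm2_weighted//.
have muZ : measurable_fun setT (fun w => (`|u (Y w)| * norm2 (Z w))%:E).
  apply/measurable_EFinP/measurable_funM => //.
  by apply: measurableT_comp => //; exact: measurableT_comp.
have uZ0 w : (0 <= (`|u (Y w)| * norm2 (Z w))%:E)%E.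
  by rewrite lee_fin mulr_ge0// sqrtr_ge0.
have C0 : 0 <= \sum_i `|q i 0| by apply: sumr_ge0.
rewrite -ge0_integralZl//; apply: ge0_le_integral => //.
- by apply: measurableT_comp => //; apply/measurable_EFinP/measurable_u_dotv.
- by apply: measurable_funeM.
- move=> w _; rewrite abse_EFin -EFinM lee_fin normrM mulrCA ler_wpM2l//.
  exact: dotv_le_norm2.
Qed.

Lemma integrable_L1_weighted (u : R -> R) (q : 'cV[R]_p) :
    L1_weighted theta (distribution P Y) u ->
  P.-integrable setT (fun w => (u (Y w) * dotv q (Z w))%:E).
Proof.
move=> [mu uoo]; apply/integrableP; split.
  exact/measurable_EFinP/measurable_u_dotv.
apply: le_lt_trans (integral_norm_dotv_le q mu) _.
rewrite lte_mul_pinfty// lee_fin; exact: sumr_ge0.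
Qed.

(** A continuous linear form that vanishes on a total family is zero. *)
Lemma total_integral0 (Psi : set (R -> R)) (q : 'cV[R]_p) :
    total_in_L1 theta (distribution P Y) Psi ->
    (forall psi, Psi psi -> \int[P]_w (psi (Y w) * dotv q (Z w))%:E = 0)%E ->
  forall u, L1_weighted theta (distribution P Y) u ->
    (\int[P]_w (u (Y w) * dotv q (Z w))%:E = 0)%E.
Proof.
move=> [PsiL1 Psitot] Psi0 u uL1.
have C0 : 0 <= \sum_i `|q i 0| by apply: sumr_ge0.
set C := \sum_i _ in C0.
apply/eqP; rewrite -abse_eq0 eq_le abse_ge0 andbT; apply/lee_addgt0Pr => e e0.
rewrite add0e.
(* [C] is 0 when [q] is 0, so the tolerance is [e / (C + 1)]; multiplied by [C] it stays below
   [e]. *)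
have C1 : 0 < C + 1 by rewrite ltr_wpDl.
have [n [c [psi [Psipsi us]]]] := Psitot u uL1 (e / (C + 1)) (divr_gt0 e0 C1).
pose s y := \sum_(k < n) c k * psi k y.
have ipsi k : P.-integrable setT (fun w => (psi k (Y w) * dotv q (Z w))%:E).
  exact/integrable_L1_weighted/PsiL1.
have sE w : ((s (Y w) * dotv q (Z w))%:E =
    \sum_(k < n) (c k)%:E * (psi k (Y w) * dotv q (Z w))%:E)%E.
  by rewrite sumEFin mulr_suml; congr EFin; apply: eq_bigr => k _; rewrite mulrA.
have ms : measurable_fun setT s.
  apply: measurable_sum => k; apply: measurable_funM => //.
  by have [] := PsiL1 _ (Psipsi k).
have iscl : P.-integrable setT (fun w => (s (Y w) * dotv q (Z w))%:E).
  under eq_fun do rewrite sE.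
  by apply: integrable_sum => // k _; exact: integrableZl.
have s0 : (\int[P]_w (s (Y w) * dotv q (Z w))%:E = 0)%E.
  under eq_integral do rewrite sE.
  rewrite integral_sum//; last by move=> k; exact: integrableZl.
  by rewrite big1// => k _; rewrite integralZl// Psi0// mule0.
have -> : (\int[P]_w (u (Y w) * dotv q (Z w))%:E =
    \int[P]_w ((u \- s) (Y w) * dotv q (Z w))%:E)%E.
  under [RHS]eq_integral do rewrite /= mulrBl EFinB.
  rewrite integralB_EFin//; first by rewrite s0 sube0.
  exact: integrable_L1_weighted.
have mus : measurable_fun setT (u \- s) by apply: measurable_funB => //; case: uL1.
apply: le_trans (le_abse_integral P measurableT _) _.
  exact/measurable_EFinP/measurable_u_dotv.
apply: le_trans (integral_norm_dotv_le q mus) _.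
apply: le_trans (lee_wpmul2l _ (ltW us)) _; first by rewrite lee_fin.
rewrite -EFinM lee_fin mulrCA -[leRHS]mulr1 ler_wpM2l ?(ltW e0)//.
by rewrite ler_pdivrMr// mul1r lerDl.
Qed.

End weighted.

(** * Matrix products by coordinates, and the equality of the span with the central subspace *)

Lemma mulmx_dotv (R : realType) (n p : nat) (A : 'M[R]_(n, p))
    (v : 'cV[R]_p) i :
  (A *m v) i 0 = dotv (row i A)^T v.
Proof. by rewrite dotvE mxE; apply: eq_bigr => j _; rewrite !mxE. Qed.

Lemma dotv_delta (R : realType) (p : nat) (v : 'cV[R]_p) i :
  dotv (delta_mx i 0) v = v i 0.
Proof.
rewrite dotvE (bigD1 i)//= mxE !eqxx mul1r big1 ?addr0// => j ji.
by rewrite mxE (negbTE ji) mul0r.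
Qed.

Lemma measurable_mulmx d (T : measurableType d) (R : realType) (n p : nat)
    (A : 'M[R]_(n, p)) (V : T -> 'cV[R]_p) :
  measurable_fun setT V -> measurable_fun setT (fun w => A *m V w).
Proof.
move=> mV; apply: measurable_fun_colP => i.
under eq_fun do rewrite mulmx_dotv.
by apply: measurableT_comp mV; exact: measurable_dotv.
Qed.

Theorem theorem4p2 (R : realType) (d : measure_display) (T : measurableType d)
  (P : probability T R) (p : nat)
  (Y : {RV P >-> R}) (X : {RV P >-> 'cV[R]_p})
  (X2 : forall i, (fun w => X w i 0) \in Lfun P 2%:E)
  (Sigma_inv : cov_mx P X \in unitmx)
  (X_density : has_density P X)
  (X_boundary : lebesgue_col p (boundary (support_of (distribution P X))) = 0%E)
  (S : 'M[R]_p) (hS : inv_sqrt (cov_mx P X) S)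
  (Z : T -> 'cV[R]_p) (hZ : forall w, Z w = S *m (X w - mean_vec P X))
  (Ec : {vspace 'cV[R]_p}) (hEc : central_subspace P Y Z Ec)
  (Pc Qc : 'M[R]_p) (hPc : orth_projection Ec Pc) (hQc : Qc = 1%:M - Pc)
  (Z2 : (\int[P]_w (norm2 (Z w) ^+ 2)%:E < +oo)%E)
  (linearity : exists EZ : T -> 'cV[R]_p,
    cond_exp_vec P (g_sigma_algebra_preimage (fun w => Pc *m Z w)) Z EZ /\
    {ae P, forall w, Qc *m EZ w = 0})
  (coverage : forall eta : 'cV[R]_p, eta \in Ec -> eta != 0 ->
    exists m : T -> R,
      cond_exp P (g_sigma_algebra_preimage Y) (fun w => dotv eta (Z w)) m /\
      'V_P[m] != 0%E)
  (theta : R -> R) (theta_ge0 : forall y, 0 <= theta y)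
  (htheta : cond_exp_fun P Y (fun w => norm2 (Z w)) theta)
  (Psi : set (R -> R)) (Psi_countable : countable Psi)
  (Psi_total : total_in_L1 theta (distribution P Y) Psi) :
  exists PsiH : set (R -> R), [/\ PsiH `<=` Psi, finite_set PsiH &
    <<[seq mean_vec P (fun w => psi (Y w) *: Z w) | psi <- fset_set PsiH]>>%VS
      = Ec].
Proof.
have mY : measurable_fun setT Y by exact: measurable_funP.
have mZ : measurable_fun setT Z.
  rewrite (funext hZ); apply: measurable_mulmx; apply: measurable_fun_colP => i.
  under eq_fun do rewrite mxE.
  apply: measurable_funD; last exact: measurable_cst.
  exact: (measurableT_comp (measurable_coor i) (measurable_funP X)).
have iL1 := integrable_L1_weighted mZ theta_ge0 htheta.
have L1ind := L1_weighted_indic theta_ge0 htheta.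
(* The constant 1, as the indicator of the whole line, belongs to the weighted space. *)
have iqZ q : P.-integrable setT (fun w => (dotv q (Z w))%:E).
  apply: eq_integrable (iL1 _ q (L1ind _ measurableT)) => // w _.
  by rewrite indicT mul1r.
have iZ i : P.-integrable setT (fun w => (Z w i 0)%:E).
  by under eq_fun do rewrite -dotv_delta.
have iPsi psi i : Psi psi ->
    P.-integrable setT (fun w => ((psi (Y w) *: Z w) i 0)%:E).
  move=> /(proj1 Psi_total)/(iL1 _ (delta_mx i 0)).
  by apply: eq_integrable => // w _; rewrite mxE dotv_delta.
have meanE psi q : Psi psi ->
    ((dotv q (mean_vec P (fun w => psi (Y w) *: Z w)))%:E =
     \int[P]_w (psi (Y w) * dotv q (Z w))%:E)%E.
  move=> Psipsi; rewrite dotv_mean_vec => [|i]; last exact: iPsi.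
  by apply: eq_integral => w _; rewrite /dotv -scalemxAr mxE.
have [[M [hM YZ]] _ _ _] := hEc.
(* [DRS] only asserts that some projection exists; uniqueness identifies it with [Pc]. *)
rewrite (orth_projection_uniq hM hPc) in YZ.
have mU : measurable_fun setT (fun w => Pc *m Z w) by exact: measurable_mulmx.
have QZ0 i A : measurable A ->
    (\int[P]_(w in Y @^-1` A) (dotv (row i Qc)^T (Z w))%:E = 0)%E.
  move: A.
  apply: (cond_independent_integral0 mU mY mZ (measurable_dotv _) (iqZ _) YZ).
  move=> A GA; have mA := g_sigma_algebra_preimage_measurable mU GA.
  have [EZ [hEZ QEZ0]] := linearity.
  have iA (V : T -> \bar R) : P.-integrable setT V -> P.-integrable A V.
    exact: integrableS.
  have iEZ j : P.-integrable setT (fun w => (EZ w j 0)%:E) by case: (hEZ j).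
  rewrite integral_dotv//; last by move=> j; exact: iA.
  (* Over an event of the sigma-algebra of [Pc *m Z], each coordinate of [Z] may be replaced by that
     of [EZ], which [Qc] kills almost surely. *)
  transitivity (\int[P]_(w in A) (dotv (row i Qc)^T (EZ w))%:E)%E.
    rewrite integral_dotv//; last by move=> j; exact: iA.
    by apply: eq_bigr => j _; have [_ _ ->] := hEZ j.
  rewrite -(integral0 P A); apply: ae_eq_integral => //.
    apply: measurable_int (integrable_dotv _ _ _) => // j; exact: iA.
  by apply: filterS QEZ0 => w Qw _; rewrite -mulmx_dotv Qw mxE.
have mean_Ec psi : Psi psi -> mean_vec P (fun w => psi (Y w) *: Z w) \in Ec.
  move=> Psipsi; set v := mean_vec _ _.
  (* Being killed by [Qc] means being fixed by [Pc], hence lying in [Ec]. *)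
  suff Qv : Qc *m v = 0.
    suff -> : v = Pc *m v by have [] := hPc v.
    by apply/eqP; rewrite -subr_eq0 -[X in X - _]mul1mx -mulmxBl -hQc Qv.
  apply/colP => i; rewrite mulmx_dotv mxE; apply: EFin_inj.
  have psiL1 := proj1 Psi_total _ Psipsi.
  rewrite meanE//; apply: (pull_out mY); [exact: iqZ|by case: psiL1|exact: iL1|].
  by move=> B mB; exact: QZ0.
have [PsiH [PsiHPsi finPsiH spanPsi]] :=
  finite_span Psi (fun psi => mean_vec P (fun w => psi (Y w) *: Z w)).
exists PsiH; split => //; set W := <<_>>%VS.
have WEc : (W <= Ec)%VS.
  apply/span_subvP => _ /mapP[psi + ->]; rewrite in_fset_set// inE.
  by move=> /PsiHPsi; exact: mean_Ec.
(* If [W] were strictly smaller, some nonzero [eta] in [Ec] would be orthogonal to it, hence to the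
   moments of all of [Psi] by [spanPsi]. *)
apply/eqP; rewrite eqEdim WEc leqNgt; apply/negP => dimW.
have [eta [etaEc eta0 etaW]] := exists_orthogonal dimW.
have etaZ0 A : measurable A ->
    (\int[P]_(w in Y @^-1` A) (dotv eta (Z w))%:E = 0)%E.
  move=> mA; rewrite integral_mkcond epatch_indic.
  rewrite -[RHS](total_integral0 mZ theta_ge0 htheta Psi_total _
    (L1ind _ mA) (q := eta)).
    by apply: eq_integral => w _; rewrite mulrC EFinM.
  by move=> psi Psipsi; rewrite -meanE// etaW// spanPsi.
have [m [hm /eqP Vm]] := coverage eta etaEc eta0; apply: Vm.
have [_ im _] := hm.
apply: variance_ae_eq0; first exact/measurable_EFinP/(measurable_int P).
(* By [etaZ0] the zero function is another version of E[eta^T Z | Y], so [m] vanishes almost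
   surely. *)
apply: (cond_exp_ae_eq mY hm); split.
- by apply/measurable_fun_g_sigma_algebra_preimageP; exact: measurable_cst.
- exact: integrable0.
- by move=> _ [B mB <-]; rewrite setTI etaZ0// integral0.
Qed.
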